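(* Let $(x_t)$ be a real-valued stationary time series admitting a weak innovations representation: causal maps $G,H$ with $\nu_t=G(x_t,x_{t-1},\dots)$, $\hat x_t=H(\nu_t,\nu_{t-1},\dots)$, $(\nu_t)$ i.i.d. $\mathcal U[0,1]$, and $(\hat x_t)\stackrel{d}{=}(x_t)$ (equality of all finite-dimensional joint distributions). Assume the decoder $H$ is injective. Define the conditional distribution functions $$F(x\mid a_{t-1},a_{t-2},\dots)=\mathbb{P}[x_t\le x\mid x_{t-1}=a_{t-1},x_{t-2}=a_{t-2},\dots],$$ $$\hat F(x\mid b_{t-1},b_{t-2},\dots)=\mathbb{P}[\hat x_t\le x\mid \nu_{t-1}=b_{t-1},\nu_{t-2}=b_{t-2},\dots].$$ Then $F(x\mid a_{t-1},a_{t-2},\dots)=\hat F(x\mid b_{t-1},b_{t-2},\dots)$, as functions of $x$, almost everywhere, for almost all $a_{t-1},a_{t-2},\dots$, where $b_s=H^{-1}(a_s,a_{s-1},\dots)$, i.e. $(b_s)$ is the (unique, by injectivity of $H$) sequence with $a_s=H(b_s,b_{s-1},\dots)$ for all $s\le t-1$.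
   Context: The weak innovations representation relaxes the Wiener–Kallianpur innovations representation by requiring only that the decoder output $(\hat x_t)$ have the same distribution as $(x_t)$, rather than equal $(x_t)$. *)

(* Defs.v *)
From HB Require Import structures.
From mathcomp Require Import all_boot all_order all_algebra.
From mathcomp Require Import all_classical all_reals all_analysis.
Set Implicit Arguments. Unset Strict Implicit. Unset Printing Implicit Defensive.
Import Order.TTheory GRing.Theory Num.Theory.
Import numFieldNormedType.Exports.
Local Open Scope classical_set_scope.
Local Open Scope ring_scope.

(* A sequence a : nat -> R encodes the past (a_s, a_{s-1}, a_{s-2}, ...)  *)
(* via a k = a_{s-k}.                                                     *)
Definition seq_cyl (R : realType) : set (set (nat -> R)) :=
  fun A => exists (k : nat) (B : set R), measurable B /\
             A = (fun a : nat -> R => a k) @^-1` B.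

Arguments seq_cyl : clear implicits.
Definition seqR (R : realType) := g_sigma_algebraType (seq_cyl R).

Definition pastR (R : realType) (Omega : Type) (X : int -> Omega -> R)
  (s : int) (w : Omega) : seqR R := fun k : nat => X (s - k%:Z) w.

Definition Hseq (R : realType) (H : seqR R -> R) (b : seqR R) : seqR R :=
  fun k : nat => H (fun j : nat => b (k + j)%N).

Definition in01 (R : realType) (b : seqR R) : Prop := forall k, 0 <= b k <= 1.

Definition decoder_injective (R : realType) (H : seqR R -> R) : Prop :=
  forall b b' : seqR R, in01 b -> in01 b' -> Hseq H b = Hseq H b' -> b = b'.

Definition fdvec (R : realType) (Omega : Type) (X : int -> Omega -> R)
  (n : nat) (ts : n.-tuple int) (w : Omega) : n.-tuple R :=
  map_tuple (fun s => X s w) ts.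

Section Procs.
Context (R : realType) (d : measure_display) (Omega : measurableType d)
        (P : probability Omega R).

Definition stationary (X : int -> Omega -> R) : Prop :=
  forall (n : nat) (ts : n.-tuple int) (h : int) (B : set (n.-tuple R)),
    measurable B ->
    P (fdvec X ts @^-1` B) = P (fdvec X (map_tuple (fun s => s + h) ts) @^-1` B).

Definition same_fdd (X Y : int -> Omega -> R) : Prop :=
  forall (n : nat) (ts : n.-tuple int) (B : set (n.-tuple R)),
    measurable B -> P (fdvec X ts @^-1` B) = P (fdvec Y ts @^-1` B).

Definition iid_uniform01 (nu : int -> Omega -> R) : Prop :=
  (forall (s : int) (B : set R), measurable B ->
     P (nu s @^-1` B) = (@lebesgue_measure R) (B `&` `[0, 1])) /\
  (forall (n : nat) (ts : n.-tuple int) (B : 'I_n -> set R),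
     uniq ts -> (forall i, measurable (B i)) ->
     P (\bigcap_(i in [set: 'I_n]) (nu (tnth ts i) @^-1` B i)) =
     (\prod_(i < n) P (nu (tnth ts i) @^-1` B i))%E).

Definition is_distribution_function (f : R -> R) : Prop :=
  [/\ {homo f : u v / u <= v},
      (forall c : R, f x @[x --> c^'+] --> f c),
      f x @[x --> -oo] --> (0 : R)
    & f x @[x --> +oo] --> (1 : R)].

(* F is (a regular version of) the conditional distribution function
   F(c | z) = P[Y <= c | Z = z] of Y given Z, Z with values in R^N *)
Definition cond_distribution_function (Y : Omega -> R) (Z : Omega -> seqR R)
  (F : R -> seqR R -> R) : Prop :=
  [/\ (forall c : R, measurable_fun [set: seqR R] (F c)),
      (forall (c : R) (B : set (seqR R)), measurable B ->
         P ([set w | Y w <= c] `&` Z @^-1` B) =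
         (\int[P]_(w in Z @^-1` B) (F c (Z w))%:E)%E)
    & forall z : seqR R, is_distribution_function (fun c => F c z)].

End Procs.

(* Main.v *)
Require Import Defs.
From HB Require Import structures.
From mathcomp Require Import all_boot all_order all_algebra.
From mathcomp Require Import all_classical all_reals all_analysis.
From mathcomp Require Import measurable_realfun.
Import Order.TTheory GRing.Theory Num.Theory.
Import numFieldNormedType.Exports.
Local Open Scope classical_set_scope.
Local Open Scope ring_scope.

Set Implicit Arguments.
Unset Strict Implicit.
(** Let Z, N and Zh be the pasts of x, nu and xhat before time t, so that
    Zh = Hseq H N. Injectivity of H makes N a function of Zh, but measurability
    of the inverse, and of the image of H, is not free. Rather than invoking the
    Lusin-Souslin theorem, take a compact subset, of almost full mass, of the
    graph of Hseq H over a measurable set D: its projection is compact, hence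
    measurable, and lies in Hseq H @` D. Exhausting the mass this way gives, for
    every measurable D, a measurable E inside Hseq H @` D such that the events
    {N in D} and {Zh in E} agree up to a null set. Hence conditioning on N and
    on Zh is the same, and since (xhat_t, Zh) and (x_t, Z) have the same law,
    F c (Hseq H b) = Fhat c b for almost every b, simultaneously for all
    rational c and then for all c by right continuity. Applying the
    construction once more to this set of b's gives a set of full measure of
    pasts a of x which are of the form Hseq H b with b good. *)

(** * Product topology and product sigma-algebra on real sequences *)

Section seqR_measurability.
Context {R : realType}.

Lemma measurable_coord (k : nat) :
  measurable_fun [set: seqR R] (fun a : seqR R => a k).
Proof.
move=> _ B mB; rewrite setTI; apply: sub_sigma_algebra.
by exists k, B.
Qed.

Lemma measurable_fun_seqR (d : measure_display) (T : measurableType d)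
    (f : T -> seqR R) :
  (forall k, measurable_fun [set: T] (fun x => f x k)) ->
  measurable_fun [set: T] f.
Proof.
move=> mf; apply: (@measurability _ _ T (seqR R) _ f (seq_cyl R)) => //.
move=> _ [_ [k [B [mB ->]]] <-]; exact: (mf k measurableT B mB).
Qed.

Lemma measurable_seqR_eq (d : measure_display) (T : measurableType d)
    (f g : T -> seqR R) :
  measurable_fun [set: T] f -> measurable_fun [set: T] g ->
  measurable [set x | f x = g x].
Proof.
move=> mf mg.
have -> : [set x | f x = g x] = \bigcap_k [set x | f x k = g x k].
  apply/seteqP; split => [x /= fg k _ /=|x /= fg]; first by rewrite fg.
  by apply/funext => k; exact: (fg k I).
apply: bigcapT_measurable => k.
rewrite (_ : [set x | _] = (fun x => f x k == g x k) @^-1` [set true]).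
  rewrite -[X in measurable X]setTI.
  by apply: measurable_fun_eqr => //; exact: (measurableT_comp (measurable_coord k)).
by apply/seteqP; split => x /eqP.
Qed.

(** Indexing by finite lists of rational data makes these basic open sets countable in number. A
    coordinate may occur several times in the list, so concatenating lists intersects boxes. *)
Definition rat_box (s : seq (nat * (rat * rat))) : set (nat -> R) :=
  [set a | all (fun i => ratr i.2.1 < a i.1 < ratr i.2.2) s].

Lemma measurable_rat_box s : measurable (rat_box s : set (seqR R)).
Proof.
elim: s => [|[k [p q]] s ih].
  by rewrite (_ : rat_box _ = setT)//; apply/seteqP; split.
rewrite (_ : rat_box _ = (fun a : seqR R => a k) @^-1` `]ratr p, ratr q[ `&` rat_box s).
  apply: measurableI => //; rewrite -[X in measurable X]setTI.
  exact: measurable_coord.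
by apply/seteqP; split=> a; rewrite /rat_box /= in_itv/= => /andP.
Qed.

(** The product topology is the supremum of the topologies induced by the coordinates. So the filter
    generated by the boxes around [a] need only be tested on one coordinate at a time, where a
    one-entry box suffices. *)
Lemma ptws_nbhs_rat_box (a : {ptws nat -> R}) (U : set {ptws nat -> R}) :
  nbhs a U -> exists2 s, rat_box s a & rat_box s `<=` U.
Proof.
pose F := filter_from [set s | rat_box s a] rat_box.
have FF : Filter F.
  apply: filter_from_filter; first by exists [::].
  move=> s1 s2 s1a s2a; exists (s1 ++ s2).
    by rewrite /rat_box/= all_cat; apply/andP; split.
  by move=> b; rewrite /rat_box/= all_cat => /andP.
suff Fa : {ptws, F --> a} by move=> /Fa.
apply/cvg_sup => i V [_] [[W oW <-]] Wai WV.
apply: filterS WV _.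
have /nbhs_ballP[e/= e0 eW] : nbhs (a i) W by exact: open_nbhs_nbhs.
have [p /[!in_itv]/= /andP[p1 p2]] : exists p, ratr p \in `](a i - e), (a i)[.
  by apply: rat_in_itvoo; rewrite ltrBlDr ltrDl.
have [q /[!in_itv]/= /andP[q1 q2]] : exists q, ratr q \in `](a i), (a i + e)[.
  by apply: rat_in_itvoo; rewrite ltrDl.
exists [:: (i, (p, q))]; first by rewrite /rat_box/= p2 q1.
move=> b; rewrite /rat_box/= andbT => /andP[pb bq].
by apply: eW; rewrite /ball/= ltr_distlC (lt_trans p1)//= (lt_trans bq).
Qed.

(** An open set is the union of the countably many rational boxes that it contains. *)
Lemma ptws_open_measurable (U : set {ptws nat -> R}) :
  open U -> measurable (U : set (seqR R)).
Proof.
move=> oU.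
have -> : U = \bigcup_s (if `[< rat_box s `<=` U >] then rat_box s else set0).
  apply/seteqP; split => [a Ua|a [s _]]; last by case: asboolP => // sU /sU.
  have [s sa sU] := ptws_nbhs_rat_box (open_nbhs_nbhs (conj oU Ua)).
  by exists s => //; rewrite asboolT.
apply: countable_bigcupT_measurable => [|s]; first exact: countableP.
by case: asboolP => // _; exact: measurable_rat_box.
Qed.

Lemma ptws_closed_measurable (C : set {ptws nat -> R}) :
  closed C -> measurable (C : set (seqR R)).
Proof.
by move=> /closed_openC/ptws_open_measurable/measurableC; rewrite setCK.
Qed.

Lemma ptws_compact_closed (K : set {ptws nat -> R}) : compact K -> closed K.
Proof.
apply: compact_closed.
exact: (@hausdorff_product nat (fun=> R) (fun=> @Rhausdorff R)).
Qed.

Lemma ptws_compact_measurable (K : set {ptws nat -> R}) :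
  compact K -> measurable (K : set (seqR R)).
Proof. by move=> /ptws_compact_closed/ptws_closed_measurable. Qed.

Lemma ptws_coord_continuous (k : nat) :
  continuous (fun a : {ptws nat -> R} => a k).
Proof. exact: (@proj_continuous nat (fun=> R) k). Qed.

Lemma ptws_coord_closed (k : nat) (B : set R) :
  closed B -> closed ((fun a : {ptws nat -> R} => a k) @^-1` B).
Proof. 
exact: (@preimage_closed {ptws nat -> R} R _ B
  (fun a _ => @ptws_coord_continuous k a)). Qed.

Lemma rat_box_open s : open (rat_box s : set {ptws nat -> R}).
Proof.
elim: s => [|[k [p q]] s ih].
  by rewrite (_ : rat_box _ = setT); [exact: openT|apply/seteqP; split].
rewrite (_ : rat_box _ =
    (fun a : {ptws nat -> R} => a k) @^-1` `]ratr p, ratr q[ `&` rat_box s).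
  apply: openI => //; apply: (@open_comp {ptws nat -> R} R).
    by move=> a _; exact: (@ptws_coord_continuous k a).
  exact: itv_open.
by apply/seteqP; split=> a; rewrite /rat_box /= in_itv/= => /andP.
Qed.

(** The preimage of a box is again a box, with coordinate indices moved by [f]. This makes the
    projections from interleaved sequences continuous. *)
Lemma ptws_reindex_continuous (f : nat -> nat) :
  continuous (fun a : {ptws nat -> R} => (a \o f : {ptws nat -> R})).
Proof.
move=> a V /ptws_nbhs_rat_box[s sa sV].
pose s' := [seq (f i.1, i.2) | i <- s].
have s's b : rat_box s' b -> rat_box s (b \o f).
  by rewrite /rat_box/= all_map.
apply: (@filterS {ptws nat -> R} (nbhs a) (nbhs_filter a) (rat_box s')).
  by move=> b /s's /sV.
apply: open_nbhs_nbhs; split; first exact: rat_box_open.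
by rewrite /rat_box/= all_map.
Qed.

End seqR_measurability.

(** * Inner regularity of probabilities on sequences: closed, then compact sets *)

Section inner_regularity.
Context {R : realType}.
Variable mu : probability (seqR R) R.
Local Notation T := {ptws nat -> R}.

(** Continuity from above: the differences decrease to the empty set and [mu] is finite. *)
Lemma measure_bigcup_tail (F : (set (seqR R))^nat) (e : R) : 0 < e ->
  (forall n, measurable (F n)) -> nondecreasing_seq F ->
  exists n, (mu (\bigcup_k F k `\` F n) <= e%:E)%E.
Proof.
move=> e0 mF ndF; pose D n := \bigcup_k F k `\` F n.
have mU : measurable (\bigcup_k F k) by exact: bigcupT_measurable.
have mD n : measurable (D n) by exact: measurableD.
have D0 : \bigcap_n D n = set0.
  by apply/seteqP; split => // x Dx; have [[k _ Fkx] _] := Dx 0%N I;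
    have [] := Dx k I.
have : mu \o D @ \oo --> 0%E.
  rewrite -(measure0 mu) -D0; apply: nonincreasing_cvg_mu => //.
  - by rewrite (le_lt_trans (probability_le1 _ _)) ?ltry.
  - exact: bigcapT_measurable.
  - by move=> m n mn; apply/subsetPset => x [Ux nFx]; split => // Fmx; apply: nFx;
      move: x Fmx {Ux}; apply/subsetPset/ndF.
move/fine_cvgP => [_ /cvgrPdist_le /(_ e e0)[n _ /(_ n (leqnn n))]] /=.
rewrite sub0r normrN => h; exists n.
have fD : mu (D n) \is a fin_num by exact: fin_num_measure.
by rewrite -/(D n) -(fineK fD) lee_fin (le_trans (ler_norm _)).
Qed.

(** Both differences are covered by the sets [A k] minus [C k], whose measures are bounded by a
    geometric series of sum [e]. *)
Lemma measure_diff_bigcap_bigcup_le (A C : (set (seqR R))^nat) (e : R) : 0 < e ->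
  (forall k, measurable (A k)) -> (forall k, measurable (C k)) ->
  (forall k, mu (A k `\` C k) <= (e / (2 ^ k.+1)%:R)%:E)%E ->
  (mu (\bigcap_k A k `\` \bigcap_k C k) <= e%:E)%E /\
  (mu (\bigcup_k A k `\` \bigcup_k C k) <= e%:E)%E.
Proof.
move=> e0 mA mC AC.
have mD k : measurable (A k `\` C k) by exact: measurableD.
have H X : measurable X -> X `<=` \bigcup_k (A k `\` C k) -> (mu X <= e%:E)%E.
  move=> mX XAC; apply: (@le_trans _ _ (\sum_(k <oo) mu (A k `\` C k))%E).
    exact: measure_sigma_subadditive.
  apply: le_trans (epsilon_trick0 xpredT (ltW e0)).
  by apply: lee_nneseries => // k _; exact: AC.
split; apply: H.
- by apply: measurableD; exact: bigcapT_measurable.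
- move=> x [Ax] /existsNP[k] /not_implyP[_ nCx].
  by exists k => //; split => //; exact: Ax.
- by apply: measurableD; exact: bigcupT_measurable.
- move=> x [[k _ Ax] nCx]; exists k => //; split => // Cx.
  by apply: nCx; exists k.
Qed.

Definition inner_closed (A : set (seqR R)) := forall e : R, 0 < e ->
  exists C : set T, [/\ closed C, C `<=` A & (mu (A `\` C) <= e%:E)%E].

Lemma inner_closed_closed (A : set T) : closed A -> inner_closed A.
Proof.
by move=> cA e e0; exists A; split => //; rewrite setDv measure0 lee_fin ltW.
Qed.

Lemma inner_closed_sequence (A : (set (seqR R))^nat) (e : R) : 0 < e ->
  (forall k, inner_closed (A k)) ->
  exists C : (set T)^nat, forall k,
    [/\ closed (C k), C k `<=` A k &
        (mu (A k `\` C k) <= (e / (2 ^ k.+1)%:R)%:E)%E].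
Proof.
move=> e0 iA; suff /choice[C CP] : forall k, exists C : set T,
    [/\ closed C, C `<=` A k & (mu (A k `\` C) <= (e / (2 ^ k.+1)%:R)%:E)%E].
  by exists C.
by move=> k; apply: iA; rewrite divr_gt0// ltr0n expn_gt0.
Qed.

Lemma inner_closed_bigcap (A : (set (seqR R))^nat) :
  (forall k, measurable (A k)) -> (forall k, inner_closed (A k)) ->
  inner_closed (\bigcap_k A k).
Proof.
move=> mA iA e e0; have [C CP] := inner_closed_sequence e0 iA.
exists (\bigcap_k C k); split.
- by apply: closed_bigI => k _; case: (CP k).
- by apply: subset_bigcap => k _; case: (CP k).
- apply: (measure_diff_bigcap_bigcup_le e0 mA _ _).1 => k; case: (CP k) => // cC _ _.
  exact: ptws_closed_measurable.
Qed.

(** A countable union of closed sets need not be closed. Half of [e] pays for approximating each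
    [A k] by a closed [C k], the other half for cutting the union of the [C k] down to a finite
    one. *)
Lemma inner_closed_bigcup (A : (set (seqR R))^nat) :
  (forall k, measurable (A k)) -> (forall k, inner_closed (A k)) ->
  inner_closed (\bigcup_k A k).
Proof.
move=> mA iA e e0; have e20 : 0 < e / 2 by rewrite divr_gt0.
have [C CP] := inner_closed_sequence e20 iA.
have mC k : measurable (C k : set (seqR R)).
  by apply: ptws_closed_measurable; case: (CP k).
pose D n : set (seqR R) := \bigcup_(k in `I_n.+1) C k.
have mD n : measurable (D n) by apply: bigcup_measurable => k _; exact: mC.
have UD : \bigcup_n D n = \bigcup_n C n.
  apply/seteqP; split => [x [n _ [k _ Cx]]|x [k _ Cx]]; first by exists k.
  by exists k => //; exists k => //=.
have ndD : nondecreasing_seq D.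
  move=> m n mn; apply/subsetPset => x [k /= km Cx].
  by exists k => //=; exact: (leq_trans km).
have [n Dn] := measure_bigcup_tail e20 mD ndD.
exists (D n); split.
- by apply: closed_bigcup => [|k _]; [exact: finite_II|case: (CP k)].
- apply: bigcup_sub => k _ x Cx.
  by exists k => //; case: (CP k) => _ + _; exact.
- have mU (B : (set (seqR R))^nat) :
      (forall k, measurable (B k)) -> measurable (\bigcup_k B k).
    exact: bigcupT_measurable.
  apply: (@le_trans _ _ (mu (\bigcup_k A k `\` \bigcup_k C k) +
                         mu (\bigcup_k D k `\` D n))%E).
    have mX : measurable (\bigcup_k A k `\` \bigcup_k C k : set (seqR R)).
      by apply: measurableD; exact: mU.
    have mY : measurable (\bigcup_k D k `\` D n).
      by apply: measurableD => //; exact: mU.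
    apply: le_trans (measureU2 mu mX mY); apply: le_measure; rewrite ?inE.
    + by apply: measurableD => //; exact: mU.
    + exact: measurableU.
    + move=> x [Ax nDx]; have [Cx|nCx] := pselect ((\bigcup_k C k) x).
        by right; rewrite UD.
      by left.
  rewrite [e]splitr EFinD; apply: leeD => //.
  by apply: (measure_diff_bigcap_bigcup_le e20 mA mC _).2 => k; case: (CP k).
Qed.

(** Asking for the approximation of the complement too makes this class stable under complement,
    hence a sigma-algebra. *)
Definition closed_regular : set (set (seqR R)) :=
  [set A | [/\ measurable A, inner_closed A & inner_closed (~` A)]].

Lemma closed_regularC A : closed_regular A -> closed_regular (~` A).
Proof. by move=> [mA iA iCA]; split; rewrite ?setCK//; exact: measurableC. Qed.

Lemma closed_regular_bigcup (A : (set (seqR R))^nat) :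
  (forall k, closed_regular (A k)) -> closed_regular (\bigcup_k A k).
Proof.
move=> rA; split.
- by apply: bigcupT_measurable => k; case: (rA k).
- by apply: inner_closed_bigcup => k; case: (rA k).
- rewrite setC_bigcup; apply: inner_closed_bigcap => k; case: (rA k) => // mA _ _.
  exact: measurableC.
Qed.

Lemma closed_regular_set0 : closed_regular set0.
Proof.
split => //; first exact/inner_closed_closed/closed0.
by rewrite setC0; exact/inner_closed_closed/closedT.
Qed.

(** An open ray is a countable union of closed rays, and its complement is closed. *)
Lemma closed_regular_ray (k : nat) (c : R) :
  closed_regular ((fun a : seqR R => a k) @^-1` `]c, +oo[).
Proof.
have mcl (B : set R) : closed B -> measurable ((fun a : seqR R => a k) @^-1` B).
  by move=> cB; apply: ptws_closed_measurable; exact: ptws_coord_closed.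
have icl (B : set R) : closed B -> inner_closed ((fun a : seqR R => a k) @^-1` B).
  by move=> cB; apply: inner_closed_closed; exact: ptws_coord_closed.
split.
- by rewrite -[X in measurable X]setTI; exact: measurable_coord.
- rewrite itvoyEbigcup preimage_bigcup; apply: inner_closed_bigcup => n.
    by apply: mcl; exact: rray_closed.
  by apply: icl; exact: rray_closed.
- by rewrite preimage_setC setCitvr; apply: icl; exact: lray_closed.
Qed.

(** Generation is used twice: the regular sets form a sigma-algebra, so cylinders suffice; for a
    fixed coordinate, the bases of regular cylinders form a sigma-algebra, so open rays suffice. *)
Lemma measurable_closed_regular (A : set (seqR R)) :
  measurable A -> closed_regular A.
Proof.
apply: (smallest_sub (C := sigma_algebra [set: nat -> R]) (G := seq_cyl R)
  (X := closed_regular)).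
  split; [exact: closed_regular_set0| |exact: closed_regular_bigcup].
  by move=> B rB; rewrite setTD; exact: closed_regularC.
move=> _ [k [B [mB ->]]].
move: mB; rewrite [X in X B -> _]RGenOInfty.measurableE.
move: B; apply: smallest_sub.
  split.
  - by rewrite /= preimage_set0; exact: closed_regular_set0.
  - by move=> B rB /=; rewrite setTD preimage_setC; exact: closed_regularC.
  - by move=> B rB /=; rewrite preimage_bigcup; exact: closed_regular_bigcup.
by move=> _ [c ->]; exact: closed_regular_ray.
Qed.

(** For each [k], choose an interval that coordinate [k] leaves with mass at most [e / 2 ^ k.+1].
    The product of these intervals is compact by Tychonoff. *)
Lemma ptws_tight (e : R) : 0 < e ->
  exists2 K : set T, compact K & (mu (~` K) <= e%:E)%E.
Proof.
move=> e0.
pose B k n : set (seqR R) := (fun a : seqR R => a k) @^-1` `[- n%:R, n%:R].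
have mB k n : measurable (B k n).
  by rewrite -[X in measurable X]setTI; exact: measurable_coord.
have /choice[N NP] : forall k, exists n,
    (mu (setT `\` B k n) <= (e / (2 ^ k.+1)%:R)%:E)%E.
  move=> k.
  have UB : \bigcup_n B k n = setT.
    apply/seteqP; split => // a _; exists (Num.truncn `|a k|).+1 => //.
    by rewrite /B /= in_itv/= -ler_norml ltW// truncnS_gt.
  rewrite -UB; apply: measure_bigcup_tail => //.
    by rewrite divr_gt0// ltr0n expn_gt0.
  move=> m n mn; apply/subsetPset => a; rewrite /B /= !in_itv/= -!ler_norml.
  by move=> /le_trans; apply; rewrite ler_nat.
exists (\bigcap_k B k (N k)).
  rewrite (_ : \bigcap_k _ = [set a : nat -> R | forall k, `[- (N k)%:R, (N k)%:R]%classic (a k)]).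
    exact: (@tychonoff nat (fun=> R) _ (fun k => @segment_compact R _ _)).
  by apply/seteqP; split => a Ba k => [|_]; exact: Ba.
have := (measure_diff_bigcap_bigcup_le e0 (fun=> measurableT) (fun k => mB k (N k)) NP).1.
by rewrite bigcapT// setTD.
Qed.

Lemma inner_compact (A : set (seqR R)) (e : R) : measurable A -> 0 < e ->
  exists K : set T, [/\ compact K, K `<=` A & (mu (A `\` K) <= e%:E)%E].
Proof.
move=> mA e0; have e20 : 0 < e / 2 by rewrite divr_gt0.
have [_ iA _] := measurable_closed_regular mA.
have [C [cC CA AC]] := iA _ e20; have [K cK mK] := ptws_tight e20.
have mC := ptws_closed_measurable cC.
have mK' := ptws_compact_measurable cK.
exists (K `&` C); split; first exact: compact_closedI.
  by move=> x [_ /CA].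
apply: (@le_trans _ _ (mu (A `\` C) + mu (~` K))%E).
  apply: le_trans (measureU2 _ _ _); rewrite ?inE.
  - apply: le_measure; rewrite ?inE.
    + by apply: measurableD => //; exact: measurableI.
    + by apply: measurableU; [exact: measurableD|exact: measurableC].
    + move=> x [Ax] /not_andP[nK|nC]; [by right|by left].
  - exact: measurableD.
  - exact: measurableC.
by rewrite [e]splitr EFinD; exact: leeD.
Qed.

End inner_regularity.

(** * Measurable subsets of images, and inversion of the decoder up to null sets *)

Section measurable_images.
Context {R : realType}.

Definition pack_mfun (d d' : measure_display) (T : measurableType d)
  (T' : measurableType d') (f : T -> T') (mf : measurable_fun [set: T] f) :
  {mfun T >-> T'} := HB.pack f (isMeasurableFun.Build _ _ _ _ f mf).

Lemma measurable_reindex (f : nat -> nat) :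
  measurable_fun [set: seqR R] (fun a : seqR R => (a \o f : seqR R)).
Proof. by apply: measurable_fun_seqR => k; exact: measurable_coord. Qed.

(* A compact set inside the graph of [h], seen in the space of interleaved
   sequences, projects to a compact, hence measurable, part of the image. *)
Lemma image_approx (mu : probability (seqR R) R) (h : seqR R -> seqR R)
    (D : set (seqR R)) (e : R) :
  measurable_fun [set: seqR R] h -> measurable D -> 0 < e ->
  exists E : set (seqR R),
    [/\ measurable E, E `<=` h @` D & (mu (D `\` h @^-1` E) <= e%:E)%E].
Proof.
move=> mh mD e0.
(* Even positions carry [b] and odd ones [h b], so a point of the graph is a single sequence and
   [inner_compact] applies to the law of [J]. *)
pose J (b : seqR R) : seqR R := fun k => if odd k then h b k./2 else b k./2.
have mJ : measurable_fun [set: seqR R] J.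
  apply: measurable_fun_seqR => k; rewrite /J; case: (odd k).
    exact: (measurableT_comp (measurable_coord _) mh).
  exact: measurable_coord.
pose ev (c : seqR R) : seqR R := c \o double.
pose od (c : seqR R) : seqR R := c \o (fun k => k.*2.+1).
have mev : measurable_fun [set: seqR R] ev by exact: measurable_reindex.
have mod : measurable_fun [set: seqR R] od by exact: measurable_reindex.
have evJ b : ev (J b) = b.
  by apply/funext => k; rewrite /ev /J /= odd_double doubleK.
have odJ b : od (J b) = h b.
  by apply/funext => k; rewrite /od /J /= odd_double /= uphalf_double.
pose Gamma := ev @^-1` D `&` [set c | od c = h (ev c)].
have mGamma : measurable Gamma.
  apply: measurableI; first by rewrite -[X in measurable X]setTI; exact: mev.
  by apply: measurable_seqR_eq => //; exact: measurableT_comp.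
have [K [cK KG GK]] := inner_compact (distribution mu (pack_mfun mJ)) mGamma e0.
have cE : @compact {ptws nat -> R} (od @` K).
  apply: (@continuous_compact {ptws nat -> R} {ptws nat -> R}) => //.
  by apply: continuous_subspaceT; exact: ptws_reindex_continuous.
have mK := ptws_compact_measurable cK.
exists (od @` K); split.
- exact: ptws_compact_measurable.
- by move=> _ [c /KG[Dc oc] <-]; exists (ev c).
(* If [b] is in [D] and [h b] is not in the [od]-image of [K], then [J b] is in [Gamma] but not in
   [K]. *)
apply: le_trans GK; rewrite /distribution /pushforward /=.
have mE := ptws_compact_measurable cE.
apply: le_measure; rewrite ?inE.
- by apply: measurableD => //; rewrite -[X in measurable X]setTI; exact: mh.
- rewrite -[X in measurable X]setTI; apply: mJ => //; exact: measurableD.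
- move=> b [Db nE]; split.
    by split; rewrite /= evJ.
  by move=> KJ; apply: nE; exists (J b).
Qed.

Lemma image_inner_measurable (mu : probability (seqR R) R)
    (h : seqR R -> seqR R) (D : set (seqR R)) :
  measurable_fun [set: seqR R] h -> measurable D ->
  exists E : set (seqR R),
    [/\ measurable E, E `<=` h @` D & mu (D `\` h @^-1` E) = 0%E].
Proof.
move=> mh mD.
have /choice[E EP] : forall n : nat, exists E : set (seqR R),
    [/\ measurable E, E `<=` h @` D &
        (mu (D `\` h @^-1` E) <= (n.+1%:R^-1)%:E)%E].
  by move=> n; apply: image_approx => //; rewrite invr_gt0.
have mU : measurable (\bigcup_n E n).
  by apply: bigcupT_measurable => n; case: (EP n).
have mpre A : measurable A -> measurable (h @^-1` A).
  by move=> mA; rewrite -[X in measurable X]setTI; exact: mh.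
exists (\bigcup_n E n); split => //.
  by move=> a [n _ Ea]; case: (EP n) => _ + _; apply.
apply/eqP; rewrite eq_le measure_ge0 andbT; apply/lee_addgt0Pr => e e0.
(* This choice gives [e^-1 < n.+1], so the error of the [n]-th approximation is below [e]. *)
rewrite add0e; pose n := Num.truncn e^-1.
apply: (@le_trans _ _ (n.+1%:R^-1)%:E).
  case: (EP n) => mE _; apply: le_trans; apply: le_measure; rewrite ?inE.
  - by apply: measurableD => //; exact: mpre.
  - by apply: measurableD => //; exact: mpre.
  - by move=> b [Db nU]; split => // Eb; apply: nU; exists n.
rewrite lee_fin invf_ple ?posrE// ltW//; exact: truncnS_gt.
Qed.

Lemma measurable_Hseq (H : seqR R -> R) :
  measurable_fun [set: seqR R] H -> measurable_fun [set: seqR R] (Hseq H).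
Proof.
move=> mH; apply: measurable_fun_seqR => k.
exact: (measurableT_comp mH (measurable_reindex (addn k))).
Qed.

(** Decoding loses no information up to null sets. Injectivity is only available on [in01]
    sequences, so [E] is taken inside the image of [B] minus a null set [A] containing all others. A
    sequence outside [A] decoded into [E] shares its image with a point of [B] outside [A], hence
    equals it. *)
Lemma decoder_sigma_algebra (mu : probability (seqR R) R) (H : seqR R -> R)
    (B : set (seqR R)) :
  measurable_fun [set: seqR R] H -> decoder_injective H ->
  {ae mu, forall b, in01 b} -> measurable B ->
  exists E : set (seqR R), [/\ measurable E,
    mu (B `\` Hseq H @^-1` E) = 0%E & mu (Hseq H @^-1` E `\` B) = 0%E].
Proof.
move=> mH injH [A [mA A0 nA]] mB; have mh := measurable_Hseq mH.
have [E [mE ED DE]] := image_inner_measurable mu mh (measurableD mB mA).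
have mhE : measurable (Hseq H @^-1` E).
  by rewrite -[X in measurable X]setTI; exact: mh.
have A01 b : ~ A b -> in01 b.
  by move=> nAb; apply: contrapT => n01; apply: nAb; exact: nA.
exists E; split => //.
- apply/negligibleP; first exact: measurableD.
  apply: (@negligibleS _ _ _ _ (A `|` ((B `\` A) `\` Hseq H @^-1` E))).
    move=> b [Bb nE]; have [Ab|nAb] := pselect (A b); first by left.
    by right.
  apply: negligibleU; apply/negligibleP => //.
  by apply: measurableD => //; exact: measurableD.
- apply/negligibleP; first exact: measurableD.
  exists A; split => // b [Eb nB]; apply: contrapT => nAb.
  have [b' [Bb' nAb'] hb'] := ED _ Eb.
  by apply: nB; rewrite -(injH _ _ (A01 _ nAb') (A01 _ nAb) hb').
Qed.

End measurable_images.

(** * Finite-dimensional distributions determine the law of the past *)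

Section process_laws.
Context {R : realType} (d : measure_display) (Omega : measurableType d)
  (P : probability Omega R).

Lemma measurable_pastR (X : int -> {RV P >-> R}) (s : int) :
  measurable_fun [set: Omega] (pastR (fun s => X s) s).
Proof. by apply: measurable_fun_seqR => k; exact: measurable_funP. Qed.

(** Unlike cylinders over one coordinate, these sets are stable under intersection. The family [B]
    is total on [nat], so boxes of different lengths are intersected after padding with [setT]. *)
Definition fd_box : set (set (seqR R)) :=
  [set A | exists (n : nat) (B : nat -> set R), (forall i, measurable (B i)) /\
    A = [set a | forall i, (i < n)%N -> B i (a i)]].

Lemma measurable_fd_box (A : set (seqR R)) : fd_box A -> measurable A.
Proof.
move=> [n [B [mB ->]]].
rewrite (_ : [set a | _] = \bigcap_(i in `I_n) ((fun a : seqR R => a i) @^-1` B i)).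
  apply: fin_bigcap_measurable => [|i _]; first exact: finite_II.
  by rewrite -[X in measurable X]setTI; exact: measurable_coord.
by apply/seteqP; split.
Qed.

Lemma fd_box_generate : @measurable _ (seqR R) = <<s fd_box >>.
Proof.
apply/seteqP; split; apply: smallest_sub; try exact: smallest_sigma_algebra.
- move=> _ [k [B [mB ->]]]; apply: sub_sigma_algebra.
  exists k.+1, (fun i => if i == k then B else setT); split.
    by move=> i; case: ifP.
  apply/seteqP; split => [a /= Ba i _|a /= /(_ k (ltnSn k))]; last by rewrite eqxx.
  by case: eqP => // ->.
- exact: measurable_fd_box.
Qed.

Lemma fd_box_setI : setI_closed fd_box.
Proof.
move=> _ _ [n [B [mB ->]]] [m [C [mC ->]]].
exists (maxn n m), (fun i => (if (i < n)%N then B i else setT) `&`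
                             (if (i < m)%N then C i else setT)); split.
  by move=> i; apply: measurableI; case: ifP.
apply/seteqP; split => [a /= [Ba Ca] i _|a /= BCa].
  by split; case: ifP => //; [exact: Ba|exact: Ca].
split => i i_lt.
  by have := BCa i; rewrite i_lt leq_max i_lt => /(_ isT)[].
by have := BCa i; rewrite i_lt leq_max i_lt orbT => /(_ isT)[].
Qed.

(** Uniqueness of finite measures on a generating pi-system, here [fd_box], where the two laws agree
    by the hypothesis on finite vectors. *)
Lemma same_fdd_pastR (X Y : int -> {RV P >-> R}) (s : int) (A : set (seqR R)) :
  same_fdd P (fun s => X s) (fun s => Y s) -> measurable A ->
  P (pastR (fun s => X s) s @^-1` A) = P (pastR (fun s => Y s) s @^-1` A).
Proof.
move=> XY.
apply: (@measure_unique _ R (seqR R) fd_box (fun=> setT) fd_box_generate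
  fd_box_setI _ _ (distribution P (pack_mfun (measurable_pastR X s)))
  (distribution P (pack_mfun (measurable_pastR Y s)))).
(* The box of length 0 is the whole space, so a constant sequence is the required covering. *)
- move=> _; exists 0%N, (fun=> setT); split => //.
  by apply/seteqP; split.
- by rewrite bigcup_const.
- move=> _ [n [B [mB ->]]]; rewrite /distribution /pushforward /=.
  (* Coordinate [i] of the past of [s] is the value at time [s - i]. *)
  pose ts := [tuple s - (i : nat)%:Z | i < n].
  pose B' := \bigcap_(i in [set: 'I_n]) ((fun t : n.-tuple R => tnth t i) @^-1` B i).
  have mB' : measurable B'.
    apply: fin_bigcap_measurable => [|i _]; first exact: finite_finset.
    by rewrite -[X in measurable X]setTI; exact: measurable_tnth.
  have preE (Z : int -> {RV P >-> R}) :
      pastR (fun s => Z s) s @^-1` [set a | forall i, (i < n)%N -> B i (a i)] =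
      fdvec (fun s => Z s) ts @^-1` B'.
    apply/seteqP; split => w /= Bw.
      by move=> i _ /=; rewrite tnth_map tnth_mktuple; exact: Bw.
    move=> i i_lt; have := Bw (Ordinal i_lt) I.
    by rewrite /= tnth_map tnth_mktuple.
  by have := XY n ts B' mB'; rewrite -(preE X) -(preE Y).
- move=> _; rewrite (le_lt_trans (probability_le1 _ _)) ?ltry//.
Qed.

End process_laws.

(** * Bounds for distribution functions and their determination by rational points *)

Section distribution_functions.
Context {R : realType}.
Implicit Types f g : R -> R.

Lemma distribution_function_ge0 f (c : R) :
  is_distribution_function f -> 0 <= f c.
Proof.
move=> [fnd _ f0 _]; rewrite -(cvg_lim (@Rhausdorff R) f0); apply: limr_le.
  by apply/cvg_ex; exists 0.
near=> x; apply: fnd; near: x; apply: nbhs_ninfty_le; exact: num_real.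
Unshelve. all: by end_near. Qed.

Lemma distribution_function_le1 f (c : R) :
  is_distribution_function f -> f c <= 1.
Proof.
move=> [fnd _ _ f1]; rewrite -(cvg_lim (@Rhausdorff R) f1); apply: limr_ge.
  by apply/cvg_ex; exists 1.
near=> x; apply: fnd; near: x; apply: nbhs_pinfty_ge; exact: num_real.
Unshelve. all: by end_near. Qed.

(** By right continuity, some rational to the right of [c] has both values within [e / 2] of those
    at [c]. *)
Lemma distribution_function_eq_rat f g (c : R) :
  is_distribution_function f -> is_distribution_function g ->
  (forall q : rat, f (ratr q) = g (ratr q)) -> f c = g c.
Proof.
move=> [_ fr _ _] [_ gr _ _] fg; apply/eqP; rewrite -subr_eq0 -normr_le0.
apply/ler_addgt0Pr => e e0; rewrite add0r.
have e20 : 0 < e / 2 by rewrite divr_gt0.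
have [r /= r0 rP] : \forall x \near c^'+,
    `|f c - f x| < e / 2 /\ `|g c - g x| < e / 2.
  by near=> x; split; near: x; [exact: cvgr_dist_lt (fr c) _ e20|
                                exact: cvgr_dist_lt (gr c) _ e20].
have [q /[!in_itv]/= /andP[cq qr]] : exists q, ratr q \in `]c, (c + r)[.
  by apply: rat_in_itvoo; rewrite ltrDl.
have [||fq gq] := rP (ratr q) => //.
  by rewrite /ball/= ltr_distlC (lt_trans _ cq) ?ltrBlDr ?ltrDl//.
rewrite (_ : f c - g c = (f c - f (ratr q)) - (g c - g (ratr q))).
  by rewrite (le_trans (ler_normB _ _))// [leRHS]splitr lerD// ltW.
by rewrite fg opprB addrA subrK.
Unshelve. all: by end_near. Qed.

End distribution_functions.

(** * Measures and integrals over sets that agree up to a null set *)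

Lemma measure_eq_diff0 (d : measure_display) (T : measurableType d)
    (R : realType) (mu : {measure set T -> \bar R}) (A B : set T) :
  measurable A -> measurable B ->
  mu (A `\` B) = 0%E -> mu (B `\` A) = 0%E -> mu A = mu B.
Proof.
move=> mA mB AB BA.
have := measureDI mu mA mB; have := measureDI mu mB mA; move: AB BA => /= -> ->.
by rewrite !add0e setIC => -> ->.
Qed.

Lemma ge0_integral_eq_diff0 (d : measure_display) (T : measurableType d)
    (R : realType) (mu : {measure set T -> \bar R}) (A B : set T)
    (f : T -> \bar R) :
  measurable A -> measurable B -> measurable_fun [set: T] f ->
  (forall x, 0 <= f x)%E ->
  mu (A `\` B) = 0%E -> mu (B `\` A) = 0%E ->
  (\int[mu]_(x in A) f x = \int[mu]_(x in B) f x)%E.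
Proof.
move=> mA mB mf f0 AB BA.
have mAB : measurable (A `\` B) by exact: measurableD.
have mBA : measurable (B `\` A) by exact: measurableD.
rewrite (@ge0_negligible_integral _ _ _ mu A _ f mAB)//; last exact: measurable_funTS.
rewrite (@ge0_negligible_integral _ _ _ mu B _ f mBA)//; last exact: measurable_funTS.
by rewrite !setDD setIC.
Qed.

(** * Conditioning on the innovations versus conditioning on the decoded past *)

Section decoder.
Context {R : realType} (d : measure_display) (Omega : measurableType d)
  (P : probability Omega R) (x nu xhat : int -> {RV P >-> R})
  (H : seqR R -> R) (t : int).
Hypothesis mH : measurable_fun [set: seqR R] H.
Hypothesis xhatE : forall s w, xhat s w = H (pastR (fun s => nu s) s w).
Hypothesis xhat_x : same_fdd P (fun s => xhat s) (fun s => x s).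
Hypothesis nu_law : forall s (B : set R), measurable B ->
  P (nu s @^-1` B) = (@lebesgue_measure R) (B `&` `[0, 1]).

Let past_x := pastR (fun s => x s) (t - 1).
Let past_nu := pastR (fun s => nu s) (t - 1).
Let past_xhat := pastR (fun s => xhat s) (t - 1).
Let muN := distribution P (pack_mfun (measurable_pastR nu (t - 1))).

Lemma Hseq_pastR w : Hseq H (past_nu w) = past_xhat w.
Proof.
apply/funext => k; rewrite /past_xhat /pastR xhatE /Hseq; congr H.
by apply/funext => j; rewrite /past_nu /pastR PoszD opprD addrA.
Qed.

Lemma past_nu_in01 : {ae muN, forall b, in01 b}.
Proof.
apply: ae_foralln => k.
exists ((fun b : seqR R => b k) @^-1` ~` `[0, 1]%classic); split.
- by rewrite -[X in measurable X]setTI; apply: measurable_coord => //; exact: measurableC.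
- have := @nu_law (t - 1 - k%:Z) (~` `[0, 1]%classic).
  by rewrite setICl measure0 => <- //; exact: measurableC.
- by move=> b /= nb; rewrite in_itv.
Qed.

(** The present value and the past before [t] are coordinate 0 and the shift of the past at [t], so
    the joint law is read off the law of one sequence. *)
Lemma past_joint_law (c : R) (E : set (seqR R)) : measurable E ->
  P ([set w | xhat t w <= c] `&` past_xhat @^-1` E) =
  P ([set w | x t w <= c] `&` past_x @^-1` E).
Proof.
move=> mE.
pose A : set (seqR R) := (fun a : seqR R => a 0%N) @^-1` `]-oo, c] `&`
  (fun a : seqR R => (a \o S : seqR R)) @^-1` E.
have mA : measurable A.
  apply: measurableI; rewrite -[X in measurable X]setTI.
    exact: measurable_coord.
  exact: measurable_reindex.
have AE (Z : int -> {RV P >-> R}) :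
    [set w | Z t w <= c] `&` pastR (fun s => Z s) (t - 1) @^-1` E =
    pastR (fun s => Z s) t @^-1` A.
  have ZS w : pastR (fun s => Z s) t w \o S = pastR (fun s => Z s) (t - 1) w.
    by apply/funext => k; rewrite /pastR /= -addn1 PoszD opprD addrCA addrC.
  have Z0 w : pastR (fun s => Z s) t w 0%N = Z t w by rewrite /pastR subr0.
  by apply/seteqP; split => w; rewrite /A /= ZS in_itv /= Z0.
by rewrite (AE xhat) (AE x); exact: same_fdd_pastR.
Qed.

Hypothesis injH : decoder_injective H.
Variables F Fhat : R -> seqR R -> R.
Hypothesis F_cond : cond_distribution_function P (x t) past_x F.
Hypothesis Fhat_cond : cond_distribution_function P (xhat t) past_nu Fhat.

(** Both sides have the same integral over every measurable [B]. Replacing [B] by the preimage of a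
    set [E] of decoded pasts turns the left integral into one over [past_xhat], then over [past_x],
    where the defining property of [F] applies; the joint law and the defining property of [Fhat]
    lead back to [B]. *)
Lemma cond_df_decoder (c : R) : {ae muN, forall b, F c (Hseq H b) = Fhat c b}.
Proof.
have [mF FP Fdf] := F_cond; have [mFhat FhatP Fhatdf] := Fhat_cond.
have mh := measurable_Hseq mH.
have mFh : measurable_fun [set: seqR R] (F c \o Hseq H) by exact: measurableT_comp.
have mpx := measurable_pastR x (t - 1).
have mpn := measurable_pastR nu (t - 1).
have mpxh := measurable_pastR xhat (t - 1).
have F0 a : (0 <= (F c a)%:E)%E by rewrite lee_fin (distribution_function_ge0 c (Fdf a)).
have Fhat0 a : (0 <= (Fhat c a)%:E)%E.
  by rewrite lee_fin (distribution_function_ge0 c (Fhatdf a)).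
suff : ae_eq muN setT (EFin \o (F c \o Hseq H)) (EFin \o Fhat c).
  by apply: filterS => b /(_ I)[].
apply: integral_ae_eq => //.
- apply: measurable_bounded_integrable => //.
    by rewrite (le_lt_trans (probability_le1 _ _)) ?ltry.
  exists 1; split => // M M1 b _ /=.
  rewrite ger0_norm ?(distribution_function_ge0 c (Fdf _))//.
  by rewrite (le_trans (distribution_function_le1 c (Fdf _)))// ltW.
- exact/measurable_EFinP.
move=> B _ mB.
have [E [mE BE EB]] := decoder_sigma_algebra mH injH past_nu_in01 mB.
have mhE : measurable (Hseq H @^-1` E).
  by rewrite -[X in measurable X]setTI; exact: mh.
have pre (f : Omega -> seqR R) A : measurable_fun setT f -> measurable A ->
    measurable (f @^-1` A).
  by move=> mf mA; rewrite -[X in measurable X]setTI; exact: mf.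
have past_xhatE : past_nu @^-1` (Hseq H @^-1` E) = past_xhat @^-1` E.
  by apply/seteqP; split => w /=; rewrite Hseq_pastR.
have mEFh : measurable_fun [set: seqR R] (EFin \o (F c \o Hseq H)).
  exact/measurable_EFinP.
rewrite (ge0_integral_eq_diff0 mB mhE mEFh (fun b => F0 (Hseq H b)) BE EB).
transitivity (\int[P]_(w in past_xhat @^-1` E) (F c (past_xhat w))%:E)%E.
  rewrite -past_xhatE (@ge0_integral_pushforward _ _ _ _ _ _ mpn P _ _ mhE).
  - by apply: eq_integral => w _ /=; rewrite -Hseq_pastR.
  - exact: measurable_funTS.
  - by move=> b _; exact: F0.
(* Domain and integrand depend on the past alone, so equality of the laws of the two pasts
   suffices. *)
transitivity (\int[P]_(w in past_x @^-1` E) (F c (past_x w))%:E)%E.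
  have mEF : measurable_fun E (EFin \o F c).
    by apply: measurable_funTS; exact/measurable_EFinP.
  rewrite -(@ge0_integral_pushforward _ _ _ _ _ _ mpxh P E (EFin \o F c) mE mEF
    (fun a _ => F0 a)).
  rewrite -(@ge0_integral_pushforward _ _ _ _ _ _ mpx P E (EFin \o F c) mE mEF
    (fun a _ => F0 a)).
  apply: (@eq_measure_integral _ _ _ _
    (distribution P (pack_mfun mpx)) (distribution P (pack_mfun mpxh))).
  by move=> A mA _; exact: (same_fdd_pastR (t - 1) xhat_x mA).
rewrite -FP// -past_joint_law//.
transitivity (\int[P]_(w in past_nu @^-1` B) (Fhat c (past_nu w))%:E)%E; last first.
  rewrite (@ge0_integral_pushforward _ _ _ _ _ _ mpn P _ _ mB)//.
    by apply: measurable_funTS; exact/measurable_EFinP.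
  by move=> b _; exact: Fhat0.
rewrite -FhatP// -past_xhatE.
have mS : measurable [set w | xhat t w <= c].
  rewrite (_ : [set w | _] = xhat t @^-1` `]-oo, c]).
    by rewrite -[X in measurable X]setTI; exact: measurable_funP.
  by apply/seteqP; split => w; rewrite /= in_itv.
(* The two events differ only where [past_nu] falls in the symmetric difference of [B] and the
   preimage of [E], which is null by [BE] and [EB]. *)
apply: measure_eq_diff0.
- by apply: measurableI => //; exact: pre.
- by apply: measurableI => //; exact: pre.
- apply/negligibleP.
    by apply: measurableD; apply: measurableI => //; exact: pre.
  exists (past_nu @^-1` (Hseq H @^-1` E `\` B)); split.
  + by apply: pre => //; exact: measurableD.
  + exact: EB.
  + by move=> w [[Sw Ew] /not_andP[|]].
- apply/negligibleP.
    by apply: measurableD; apply: measurableI => //; exact: pre.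
  exists (past_nu @^-1` (B `\` Hseq H @^-1` E)); split.
  + by apply: pre => //; exact: measurableD.
  + exact: BE.
  + by move=> w [[Sw Ew] /not_andP[|]].
Qed.

(** The null set of [cond_df_decoder] depends on [c]. Only countably many are united, one for each
    rational, and right continuity supplies the remaining [c]. *)
Lemma cond_df_decoder_ae : {ae muN, forall b,
  in01 b /\ forall c, F c (Hseq H b) = Fhat c b}.
Proof.
have [_ _ Fdf] := F_cond; have [_ _ Fhatdf] := Fhat_cond.
(* Rationals are enumerated through their codes in [nat]; a number coding no rational imposes no
   condition. *)
have : {ae muN, forall b, forall n, if @unpickle rat n is Some q
    then F (ratr q) (Hseq H b) = Fhat (ratr q) b else True}.
  apply: ae_foralln => n; case: unpickle => [q|]; first exact: cond_df_decoder.
  exact: nearW.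
apply: filterS2 past_nu_in01 => b b01 bq; split => // c.
apply: (@distribution_function_eq_rat _ (fun c => F c (Hseq H b)) (fun c => Fhat c b)) => //.
by move=> q; have := bq (pickle q); rewrite pickleK.
Qed.

End decoder.

(** * Transfer from innovation pasts to pasts of the series *)

Unset Implicit Arguments.
Set Strict Implicit.

Theorem theorem2 (R : realType) (d : measure_display) (Omega : measurableType d)
  (P : probability Omega R)
  (x nu xhat : int -> {RV P >-> R}) (G H : seqR R -> R)
  (t : int) (F Fhat : R -> seqR R -> R) :
  stationary P (fun s => x s) ->
  measurable_fun [set: seqR R] G ->
  measurable_fun [set: seqR R] H ->
  (forall (s : int) (w : Omega), nu s w = G (pastR (fun s => x s) s w)) ->
  (forall (s : int) (w : Omega), xhat s w = H (pastR (fun s => nu s) s w)) ->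
  iid_uniform01 P (fun s => nu s) ->
  same_fdd P (fun s => xhat s) (fun s => x s) ->
  decoder_injective H ->
  cond_distribution_function P (x t) (pastR (fun s => x s) (t - 1)) F ->
  cond_distribution_function P (xhat t) (pastR (fun s => nu s) (t - 1)) Fhat ->
  {ae pushforward P (pastR (fun s => x s) (t - 1)), forall a : seqR R,
     (exists b : seqR R, in01 b /\ Hseq H b = a) /\
     (forall b : seqR R, in01 b -> Hseq H b = a ->
        {ae (@lebesgue_measure R), forall c : R, F c a = Fhat c b})}.
Proof.
move=> _ _ mH _ xhatE [nu_law _] xhat_x injH F_cond Fhat_cond.
have mh := measurable_Hseq mH.
have [A [mA A0 nA]] :=
  cond_df_decoder_ae mH xhatE xhat_x nu_law injH F_cond Fhat_cond.
(* Every point of [E] is decoded from a sequence outside the exceptional null set [A], and almost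
   every innovation past is decoded into [E]. *)
have [E [mE EA AE]] := image_inner_measurable
  (distribution P (pack_mfun (measurable_pastR nu (t - 1)))) mh (measurableC mA).
exists (~` E); split; first exact: measurableC.
(* The mass of the complement of [E] is moved from the past of [x] to that of [xhat], then to that
   of [nu], where it is carried by [A] and the null part of its complement not decoded into [E]. *)
- transitivity (P (pastR (fun s => xhat s) (t - 1) @^-1` ~` E)).
    by apply/esym/same_fdd_pastR => //; exact: measurableC.
  have mhE : measurable (Hseq H @^-1` ~` E).
    by rewrite -[X in measurable X]setTI; apply: mh => //; exact: measurableC.
  transitivity (distribution P (pack_mfun (measurable_pastR nu (t - 1)))
                  (Hseq H @^-1` ~` E)).
    rewrite /distribution /pushforward /=; congr (P _).
    by apply/seteqP; split => w /=; rewrite (Hseq_pastR t xhatE).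
  apply/negligibleP => //.
  apply: (@negligibleS _ _ _ _ (A `|` (~` A `\` Hseq H @^-1` E))).
    by move=> b nE; have [Ab|nAb] := pselect (A b); [left|right].
  apply: negligibleU; apply/negligibleP => //.
  apply: measurableD; first exact: measurableC.
  by rewrite -[X in measurable X]setTI; exact: mh.
- move=> a; apply: contra_not => /EA[b nAb <-].
  have [b01 Fb] : in01 b /\ forall c, F c (Hseq H b) = Fhat c b.
    by apply: contrapT => nb; apply: nAb; exact: nA.
  split; first by exists b.
  (* Injectivity identifies any preimage [b'] with the good [b], for which equality holds at every
     [c]. *)
  move=> b' b'01 /(injH _ _ b'01 b01) ->.
  exact: aeW.
Qed.
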